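(* There exists a constant $C>0$ such that for all $\xi,\eta\in\mathbb R$, for any eigenvalues $\lambda_j(\xi),\lambda_{j'}(\eta)$ with $1\le j,j'\le6$, and for all $u,v\in\mathbb C^9$, $$\big|\Pi_sB\big(\Pi_j(\xi)u,\Pi_{j'}(\eta)v\big)\big|\le C\,|\lambda_j(\xi)+\lambda_{j'}(\eta)|\,|u|\,|v|.$$
   Context: Vectors of $\mathbb C^9$ are written $u=(u^1,u^2,u^3)$ or $(E,H,M)$ with blocks in $\mathbb C^3$; $e_1=(1,0,0)$, $\times$ is the (complex bilinear) cross product. Set $$A(e_1)(E,H,M)=(-e_1\times H,\ e_1\times E,\ 0),\quad L_0(E,H,M)=(0,\ -e_1\times H+e_1\times M,\ e_1\times H-e_1\times M),$$ $$B(u,v)=\tfrac12\big(0,\ u^3\times v^2+v^3\times u^2,\ -(u^3\times v^2+v^3\times u^2)\big),\qquad \Pi_s=\mathrm{diag}(1,0,0,1,0,0,1,0,0).$$ For $\xi\in\mathbb R$ the Hermitian matrix $A(e_1)\xi+L_0/i$ has the spectral decomposition $\sum_{j=1}^9\lambda_j(\xi)\Pi_j(\xi)$, with orthogonal eigenprojectors $\Pi_j(\xi)$, where $\lambda_7=\lambda_8=\lambda_9=0$ and $\Pi_7+\Pi_8+\Pi_9=\Pi_s$, while $\lambda_1,\dots,\lambda_6$ are the continuous branches satisfying $$\xi^2=\frac{\lambda_j(\xi)+2\delta_j}{\lambda_j(\xi)+\delta_j}\lambda_j(\xi)^2,\quad\delta_j=(-1)^j,\qquad\lambda_1\ge2,\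 \lambda_2\ge0,\ 0\le\lambda_3<1,\ \lambda_j=-\lambda_{7-j}.$$ For $\xi\ne0$ the eigenvalues $\lambda_1>\lambda_2>\lambda_3>0>\lambda_4>\lambda_5>\lambda_6$ are simple, and $\Pi_j(\xi)$ ($1\le j\le 6$) is the rank-one orthogonal projector onto the span of $Q_j(\xi)=\big(-\frac{i\delta_j\xi}{\lambda_j}\Omega_j,\Omega_j,-\gamma_j\Omega_j\big)$ with $\Omega_j=(0,i\delta_j,1)$ and $\gamma_j=1-\xi^2/\lambda_j^2$; $\Pi_j(0)$ denotes the limit of $\Pi_j(\xi)$ as $\xi\to0^+$. *)

(* Defs.v *)
From HB Require Import structures.
From mathcomp Require Import all_boot all_order all_algebra complex spectral.
From mathcomp Require Import all_classical all_reals all_analysis.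

Set Implicit Arguments.
Unset Strict Implicit.
Unset Printing Implicit Defensive.

Import Order.TTheory GRing.Theory Num.Theory numFieldNormedType.Exports.

Local Open Scope classical_set_scope.
Local Open Scope ring_scope.

(* [R[i]] packed as a [numClosedFieldType]: the topology that MathComp-Analysis
   puts on numeric fields is found on [CC R], but not on the bare type [R[i]]. *)
Definition CC (R : realType) : numClosedFieldType := complex R.

Definition toC (R : realType) (x : R) : CC R := real_complex R x.

(* Vectors are row vectors, as in MathComp's [eigenspace] and [proj_ortho]; an
   operator f acts by right multiplication by [lin1_mx f]. *)
Notation vec3 R := 'rV[CC R]_3.
Notation vec9 R := 'rV[CC R]_(3 + (3 + 3)).

Section Vectors.
Variable R : realType.

Definition mkvec (E H M : vec3 R) : vec9 R := row_mx E (row_mx H M).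
Definition block1 (u : vec9 R) : vec3 R := lsubmx u.
Definition block2 (u : vec9 R) : vec3 R := lsubmx (rsubmx u).
Definition block3 (u : vec9 R) : vec3 R := rsubmx (rsubmx u).

Definition triple (a b c : CC R) : vec3 R :=
  \row_(k < 3) nth 0 [:: a; b; c] k.

Definition e1 : vec3 R := triple 1 0 0.

Definition cross (a b : vec3 R) : vec3 R :=
  let a_ k := a 0 (inord k) in let b_ k := b 0 (inord k) in
  triple (a_ 1 * b_ 2 - a_ 2 * b_ 1)
         (a_ 2 * b_ 0 - a_ 0 * b_ 2)
         (a_ 0 * b_ 1 - a_ 1 * b_ 0).

Definition vnorm (u : vec9 R) : R :=
  Num.sqrt (\sum_k (Normc.normc (u 0 k)) ^+ 2).

Definition A_e1 (u : vec9 R) : vec9 R :=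
  mkvec (- cross e1 (block2 u)) (cross e1 (block1 u)) 0.

Definition L0 (u : vec9 R) : vec9 R :=
  mkvec 0 (- cross e1 (block2 u) + cross e1 (block3 u))
          (cross e1 (block2 u) - cross e1 (block3 u)).

Definition B (u v : vec9 R) : vec9 R :=
  let w := cross (block3 u) (block2 v) + cross (block3 v) (block2 u) in
  2^-1 *: mkvec 0 w (- w).

(* The diagonal is (e1, e1, e1) = (1, 0, 0, 1, 0, 0, 1, 0, 0). *)
Definition Pi_s : 'M[CC R]_(3 + (3 + 3)) := diag_mx (mkvec e1 e1 e1).

Definition symbol_op (xi : R) (u : vec9 R) : vec9 R :=
  toC xi *: A_e1 u + 'i^-1 *: L0 u.

Definition symbol (xi : R) : 'M[CC R]_(3 + (3 + 3)) := lin1_mx (symbol_op xi).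

End Vectors.

Section Branches.
Variable R : realType.

Definition delta (j : nat) : R := (-1) ^+ j.

(* Only the indices 1 <= j <= 6 matter. The denominators never vanish: the
   range conditions force lambda j xi + delta j != 0. *)
Record branches (lambda : nat -> R -> R) : Prop := Branches {
  branch_continuous : forall j, (1 <= j <= 6)%N -> continuous (lambda j);
  branch_dispersion : forall j xi, (1 <= j <= 6)%N ->
    xi ^+ 2 = (lambda j xi + 2 * delta j) / (lambda j xi + delta j)
              * lambda j xi ^+ 2;
  branch1_ge2 : forall xi, 2 <= lambda 1%N xi;
  branch2_ge0 : forall xi, 0 <= lambda 2%N xi;
  branch3_itv : forall xi, 0 <= lambda 3%N xi < 1;
  branch_sym : forall j xi, (1 <= j <= 6)%N ->
    lambda j xi = - lambda (7 - j)%N xi }.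

Variable lambda : nat -> R -> R.

Definition eigenproj (j : nat) (xi : R) : 'M[CC R]_(3 + (3 + 3)) :=
  proj_ortho (eigenspace (symbol xi) (toC (lambda j xi))).

(* At xi = 0 eigenvalues cross (lambda 2, ..., lambda 5 all vanish there), so
   the projector of the branch is the limit of the eigenprojectors and not the
   projector onto the whole eigenspace. *)
Definition Pi (j : nat) (xi : R) : 'M[CC R]_(3 + (3 + 3)) :=
  if xi == 0 then lim (eigenproj j x @[x --> 0^'+]) else eigenproj j xi.

End Branches.

(* Main.v *)
Require Import Defs.
From HB Require Import structures.
From mathcomp Require Import all_boot all_order all_algebra complex.
From mathcomp Require Import sesquilinear spectral.
From mathcomp Require Import all_classical all_reals all_analysis.
From mathcomp Require Import ring lra.

(** Each vector in the range of [Pi j xi], [xi = 0] included, is a multiple of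
    a vector [(a W, b W, W)] with [W = (0, i d, 1)], [d = delta j = +-1] and
    [b = 1 + d * lambda j xi].  The transverse plane is the sum of the two
    eigenlines of [e1 x -], for the eigenvalues [i d] and [- i d]; on the line
    of [W] the third block of the eigenvalue equation reads
    [d (b - 1) = lambda], and for nonzero [xi] the eigenvalue equation has no
    nonzero solution on the other line.  This is [eigenspace_polarized].  So
    for nonzero [xi] the eigenprojector is an explicit rank-one matrix.

    At [xi = 0] the only ingredient of this matrix that is not obviously
    continuous is the ratio [xi / lambda j xi].  By the dispersion relation it
    is [+- sqrt ((lambda + 2 d) / (lambda + d))] for [xi > 0], with a sign
    depending on [j] only, and this expression is continuous.  Hence the limit
    defining [Pi j 0] exists and is again the projector onto a vector
    [(a W, b W, W)] ([PiE]).

    For two such vectors, with parameters [d, b] and [d', b'], the product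
    [u3 x v2 + v3 x u2] equals [(b' - b) (W x W')], and [W x W'] is
    [i (d - d')] times the first basis vector.  Since [d ^ 2 = d' ^ 2 = 1],
      [(d - d') (b' - b) = (d d' - 1) (lambda + mu)],
    so the sum of the eigenvalues factors out exactly: this is the
    compatibility (transparency) of [B] with the spectrum.  Finally the third
    block of the spanning vector is the fixed vector [W], whose norm is at
    least 1, so the coefficients of the projections of [u] and [v] along the
    spanning vectors are bounded by [|u|] and [|v|] (Cauchy-Schwarz). *)

Set Implicit Arguments.
Unset Strict Implicit.
Unset Printing Implicit Defensive.

Import Order.TTheory GRing.Theory Num.Theory numFieldNormedType.Exports.

Local Open Scope classical_set_scope.
Local Open Scope ring_scope.

Local Notation "''[' u , v ]" := (dotmx u v) : ring_scope.
Local Notation "''[' u ]" := (dotmx u u) : ring_scope.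

(** * Orthogonal projectors onto lines *)

Section LineProjector.
Variable C : numClosedFieldType.

Lemma dotmx_sum n (u v : 'rV[C]_n) : '[u, v] = \sum_k u 0 k * (v 0 k)^*.
Proof. by rewrite dotmxE mxE; apply: eq_bigr => k _; rewrite !mxE. Qed.

Definition line_proj n (q : 'rV[C]_n) : 'M[C]_n :=
  '[q]^-1 *: ((q ^t*)%sesqui *m q).

Lemma mul_line_proj n (q u : 'rV[C]_n) :
  u *m line_proj q = ('[u, q] / '[q]) *: q.
Proof.
rewrite -scalemxAr mulmxA [u *m _]mx11_scalar -dotmxE mul_scalar_mx.
by rewrite scalerA mulrC.
Qed.

Lemma proj_ortho_line m n (V : 'M[C]_(m, n)) (q : 'rV[C]_n) :
  q != 0 -> (V :=: q)%MS -> proj_ortho V = line_proj q.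
Proof.
move=> q0 Vq; apply/row_matrixP => i; rewrite !rowE mul_line_proj.
move: (delta_mx 0 i) => u; set c := _ / _.
have qq0 : '[q] != 0 by rewrite gt_eqF// dotmx_is_dotmx.
rewrite -[u in LHS](subrK (c *: q)) mulmxDl proj_ortho_0 ?add0r.
  by rewrite proj_ortho_id// Vq scalemx_sub.
rewrite orthomx_sym Vq orthomx_sym orthomx1E; apply/eqP/rowP => k.
have : '[u - c *: q, q] = 0 by rewrite linearBl linearZl_LR /= divfK // subrr.
by rewrite dotmxE !ord1 => ->; rewrite mxE.
Qed.

(** By Cauchy-Schwarz [c = '[u, q] / '[q]] is at most [|u| / |q|] in modulus. *)
Lemma line_proj_coef n (q u : 'rV[C]_n) :
  1 <= '[q] -> exists2 c, u *m line_proj q = c *: q & `|c| ^+ 2 <= '[u].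
Proof.
move=> q1; have q0 : 0 < '[q] := lt_le_trans ltr01 q1.
exists ('[u, q] / '[q]); first exact: mul_line_proj.
rewrite normrM normfV (gtr0_norm q0) exprMn exprVn ler_pdivrMr ?exprn_gt0//.
apply: le_trans (CauchySchwarz (@dotmx C n) u q) _.
by rewrite ler_wpM2l ?dnorm_ge0// expr2 ler_peMl// ltW.
Qed.

End LineProjector.

(** * Continuity of the projector onto a line *)

Lemma cvg_mx_coord (K : topologicalType) m n (T : Type) (F : set_system T)
    (f : T -> 'M[K]_(m, n)) (M : 'M[K]_(m, n)) :
  Filter F -> (forall i j, f x i j @[x --> F] --> M i j) -> f @ F --> M.
Proof.
move=> FF fM A [P MP PA].
have FP : \forall x \near F, forall i j, P i j (f x i j).
  apply: filter_forall => i; apply: filter_forall => j.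
  exact: (fM i j _ (MP i j)).
by rewrite /nbhs /=; apply: filterS FP => x /PA.
Qed.

Lemma cvg_sum_seq (K : numFieldType) (I : Type) (r : seq I) (T : Type)
    (F : set_system T) (f : I -> T -> K) (l : I -> K) :
  Filter F -> (forall i, f i x @[x --> F] --> l i) ->
  \sum_(i <- r) f i x @[x --> F] --> \sum_(i <- r) l i.
Proof.
by move=> FF fl; apply: (@cvg_big K I +%R 0 xpredT) => //; exact: add_continuous.
Qed.

Section LineProjectorLimit.
Variable C : numClosedFieldType.

Lemma conjC_continuous : continuous (fun z : C => z^*).
Proof.
move=> z; apply: (iffRL (@cvgrPdist_lt _ _ _ (nbhs z) _ _ _)) => e e0.
near=> w; rewrite -rmorphB norm_conjC; near: w.
by apply/nbhs_ballP; exists e.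
Unshelve. all: by end_near. Qed.

Lemma cvg_line_proj n (T : Type) (F : set_system T)
    (q : T -> 'rV[C]_n) (q0 : 'rV[C]_n) :
  Filter F -> q0 != 0 -> (forall k, q x 0 k @[x --> F] --> q0 0 k) ->
  line_proj (q x) @[x --> F] --> line_proj q0.
Proof.
move=> FF q00 qq0.
have cc k : (q x 0 k)^* @[x --> F] --> (q0 0 k)^*.
  apply: (@continuous_cvg _ _ _ _ _ _ (fun z : C => z^*)) => //.
  exact: conjC_continuous.
have dd : '[q x] @[x --> F] --> '[q0].
  rewrite dotmx_sum; under eq_fun do rewrite dotmx_sum.
  by apply: cvg_sum_seq => k; exact: cvgM.
apply: cvg_mx_coord => i j; rewrite mxE; under eq_fun do rewrite mxE.
apply: cvgM; first by apply: cvgV => //; rewrite gt_eqF// dotmx_is_dotmx.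
rewrite mxE big_ord1 !mxE; under eq_fun do rewrite mxE big_ord1 !mxE.
exact: cvgM.
Qed.

Lemma cvg_line_proj_affine n (e h m : 'rV[C]_n) (T : Type) (F : set_system T)
    (a b : T -> C) (a0 b0 : C) :
  Filter F -> a0 *: e + b0 *: h + m != 0 ->
  a x @[x --> F] --> a0 -> b x @[x --> F] --> b0 ->
  line_proj (a x *: e + b x *: h + m) @[x --> F] -->
  line_proj (a0 *: e + b0 *: h + m).
Proof.
move=> FF q0 aa0 bb0; apply: cvg_line_proj => // k.
rewrite !mxE; under eq_fun do rewrite !mxE.
apply: cvgD; last exact: cvg_cst.
by apply: cvgD; apply: cvgM => //; exact: cvg_cst.
Qed.

End LineProjectorLimit.

(** * Real numbers inside the complex numbers *)

HB.instance Definition _ (R : realType) :=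
  GRing.RMorphism.copy (@toC R) (real_complex R).

Section RealComplex.
Variable R : realType.

Lemma toC_le (x y : R) : (toC x <= toC y) = (x <= y).
Proof. exact: lecR. Qed.

Lemma norm_toC (x : R) : `|toC x| = toC `|x|.
Proof. by rewrite /toC normc_def /= expr0n /= addr0 sqrtr_sqr. Qed.

Lemma vnorm_ge0 (u : vec9 R) : 0 <= vnorm u.
Proof. exact: sqrtr_ge0. Qed.

Lemma sqr_toC_vnorm (u : vec9 R) : toC (vnorm u) ^+ 2 = '[u].
Proof.
rewrite -rmorphXn /= /vnorm sqr_sqrtr; last first.
  by apply: sumr_ge0 => k _; exact: sqr_ge0.
rewrite dotmx_sum rmorph_sum; apply: eq_bigr => k _.
by rewrite -normCK rmorphXn.
Qed.

Lemma toC_continuous : continuous (@toC R).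
Proof.
move=> x; apply/cvgrPdist_lt => e e0.
(* A positive complex number is real. *)
have [r /andP[r0 re]] : exists r : R, (0 < r) && (toC r <= e).
  exists (complex.Re e); case: e e0 => a b; rewrite ltcE /= => /andP[/eqP -> a0].
  by rewrite a0 /toC /= lecE /= eqxx lexx.
near=> y; rewrite -rmorphB norm_toC (lt_le_trans _ re)// ltcR.
near: y; exact: cvgr_dist_lt.
Unshelve. all: by end_near. Qed.

Lemma cvg_toC (T : Type) (F : set_system T) (a : T -> R) (a0 : R) :
  Filter F -> a x @[x --> F] --> a0 -> toC (a x) @[x --> F] --> toC a0.
Proof. by move=> FF aa0; apply: cvg_comp aa0 _; exact: toC_continuous. Qed.

End RealComplex.

(** * Coordinates *)

Section Coordinates.
Variable R : realType.
Implicit Types (E H M : vec3 R) (u : vec9 R).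

Lemma block1_mkvec E H M : block1 (mkvec E H M) = E.
Proof. by rewrite /block1 row_mxKl. Qed.

Lemma block2_mkvec E H M : block2 (mkvec E H M) = H.
Proof. by rewrite /block2 row_mxKr row_mxKl. Qed.

Lemma block3_mkvec E H M : block3 (mkvec E H M) = M.
Proof. by rewrite /block3 !row_mxKr. Qed.

Definition blocksE := (block1_mkvec, block2_mkvec, block3_mkvec).

Lemma triple0 (a b c : CC R) : triple a b c 0 (inord 0) = a.
Proof. by rewrite mxE inordK. Qed.

Lemma triple1 (a b c : CC R) : triple a b c 0 (inord 1) = b.
Proof. by rewrite mxE inordK. Qed.

Lemma triple2 (a b c : CC R) : triple a b c 0 (inord 2) = c.
Proof. by rewrite mxE inordK. Qed.

Definition tripleE := (triple0, triple1, triple2).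

Lemma triple_eta (a : vec3 R) :
  a = triple (a 0 (inord 0)) (a 0 (inord 1)) (a 0 (inord 2)).
Proof.
apply/rowP => k; rewrite mxE -[k in LHS]inord_val.
by case: k => [[|[|[|//]]]].
Qed.

Lemma vec9_eta u : exists x0 x1 x2 y0 y1 y2 z0 z1 z2 : CC R,
  u = mkvec (triple x0 x1 x2) (triple y0 y1 y2) (triple z0 z1 z2).
Proof.
have -> : u = mkvec (block1 u) (block2 u) (block3 u).
  by rewrite /mkvec !hsubmxK.
rewrite (triple_eta (block1 u)) (triple_eta (block2 u)) (triple_eta (block3 u)).
by do 9!eexists.
Qed.

Lemma triple_inj (x y z x' y' z' : CC R) :
  triple x y z = triple x' y' z' -> [/\ x = x', y = y' & z = z'].
Proof.
by move=> e; split; [move: (triple0 x y z)|move: (triple1 x y z)|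
  move: (triple2 x y z)]; rewrite e tripleE.
Qed.

Lemma mkvec_inj E H M E' H' M' :
  mkvec E H M = mkvec E' H' M' -> [/\ E = E', H = H' & M = M'].
Proof. by case/eq_row_mx => -> /eq_row_mx[-> ->]. Qed.

Lemma mkvecD E H M E' H' M' :
  mkvec E H M + mkvec E' H' M' = mkvec (E + E') (H + H') (M + M').
Proof. by rewrite /mkvec !add_row_mx. Qed.

Lemma mkvecZ (z : CC R) E H M :
  z *: mkvec E H M = mkvec (z *: E) (z *: H) (z *: M).
Proof. by rewrite /mkvec !scale_row_mx. Qed.

Lemma tripleD (x y z x' y' z' : CC R) :
  triple x y z + triple x' y' z' = triple (x + x') (y + y') (z + z').
Proof. by apply/rowP => -[[|[|[|//]]] ?]; rewrite !mxE. Qed.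

Lemma tripleZ (t x y z : CC R) :
  t *: triple x y z = triple (t * x) (t * y) (t * z).
Proof. by apply/rowP => -[[|[|[|//]]] ?]; rewrite !mxE. Qed.

Lemma tripleN (x y z : CC R) : - triple x y z = triple (- x) (- y) (- z).
Proof. by apply/rowP => -[[|[|[|//]]] ?]; rewrite !mxE. Qed.

Lemma triple000 : triple 0 0 0 = 0 :> vec3 R.
Proof. by apply/rowP => -[[|[|[|//]]] ?]; rewrite !mxE. Qed.

Definition coordE := (mkvecD, mkvecZ, tripleN, tripleD, tripleZ).

Lemma cross_triple (x y z x' y' z' : CC R) :
  cross (triple x y z) (triple x' y' z') =
  triple (y * z' - z * y') (z * x' - x * z') (x * y' - y * x').
Proof. by rewrite /cross !tripleE. Qed.

Lemma dotmx_mkvec E H M : '[mkvec E H M] = '[E] + '[H] + '[M].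
Proof.
rewrite !dotmx_sum /mkvec !big_split_ord /= addrA.
by congr (_ + _ + _); apply: eq_bigr => k _; rewrite ?row_mxEr ?row_mxEl.
Qed.

Lemma dotmx_triple (x y z : CC R) :
  '[triple x y z] = `|x| ^+ 2 + `|y| ^+ 2 + `|z| ^+ 2.
Proof.
by rewrite dotmx_sum !big_ord_recl big_ord0 !mxE /= addr0 addrA !normCK.
Qed.

Lemma mul_Pi_s (x0 x1 x2 y0 y1 y2 z0 z1 z2 : CC R) :
  mkvec (triple x0 x1 x2) (triple y0 y1 y2) (triple z0 z1 z2) *m Pi_s R =
  mkvec (triple x0 0 0) (triple y0 0 0) (triple z0 0 0).
Proof.
rewrite /Pi_s mul_mx_diag; apply/rowP => k; rewrite !mxE.
by case: (fintype.split _) => [i|i]; rewrite !mxE;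
  [|case: (fintype.split _) => {}i; rewrite !mxE];
  case: i => [[|[|[|//]]] ?] /=; rewrite ?mulr1 ?mulr0.
Qed.

Lemma B_mkvec E H M E' H' M' :
  B (mkvec E H M) (mkvec E' H' M') =
  2^-1 *: mkvec 0 (cross M H' + cross M' H) (- (cross M H' + cross M' H)).
Proof. by rewrite /B !block2_mkvec !block3_mkvec. Qed.

End Coordinates.

(** * Eigenvectors of the symbol *)

Section Symbol.
Variable R : realType.

Lemma symbol_op_coords (xi : R) (x0 x1 x2 y0 y1 y2 z0 z1 z2 : CC R) :
  symbol_op xi (mkvec (triple x0 x1 x2) (triple y0 y1 y2) (triple z0 z1 z2)) =
  mkvec (triple 0 (toC xi * y2) (- (toC xi * y1)))
    (triple 0 (- (toC xi * x2) - 'i * (y2 - z2))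
              (toC xi * x1 + 'i * (y1 - z1)))
    (triple 0 ('i * (y2 - z2)) (- ('i * (y1 - z1)))).
Proof.
rewrite /symbol_op /A_e1 /L0 !(blocksE R) /e1 !cross_triple -triple000.
rewrite !(coordE R) invCi.
by congr (mkvec (triple _ _ _) (triple _ _ _) (triple _ _ _)); ring.
Qed.

Lemma symbol_op_linear (xi : R) : linear (symbol_op xi).
Proof.
move=> c u v.
have [x0 [x1 [x2 [y0 [y1 [y2 [z0 [z1 [z2 ->]]]]]]]]] := vec9_eta u.
have [x0' [x1' [x2' [y0' [y1' [y2' [z0' [z1' [z2' ->]]]]]]]]] := vec9_eta v.
rewrite !(coordE R) !symbol_op_coords !(coordE R).
by congr (mkvec (triple _ _ _) (triple _ _ _) (triple _ _ _)); ring.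
Qed.

HB.instance Definition _ (xi : R) :=
  GRing.isLinear.Build (CC R) (vec9 R) (vec9 R) *:%R (symbol_op xi)
    (symbol_op_linear xi).

Lemma mul_symbol (xi : R) (u : vec9 R) : u *m symbol xi = symbol_op xi u.
Proof. exact: mul_rV_lin1. Qed.

(** For [d = +-1], the eigenvector of [e1 x -] for the eigenvalue [i d]. *)
Definition Omega (d : R) : vec3 R := triple 0 ('i * toC d) 1.

(** The factor [-i] makes both amplitudes real on the eigenvectors of the
    symbol. *)
Definition polarized (d a b : R) : vec9 R :=
  mkvec (toC a *: (- 'i *: Omega d)) (toC b *: Omega d) (Omega d).

(** With [s = xi / l], the vector
    [polarized d (ampE d s l) (ampH d l)] is a multiple of the usual
    eigenvector [(- i d s W, W, - g W)], where [W = Omega d] and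
    [g = 1 - s ^ 2 = - d / (l + d)]: it is divided by [- g], which tends to 0
    when [l] is large. *)
Definition ampE (d s l : R) : R := d * s * (1 + d * l).
Definition ampH (d l : R) : R := 1 + d * l.

Lemma toC_ampE d s l : toC (ampE d s l) = toC d * toC s * (1 + toC d * toC l).
Proof. by rewrite /ampE !(rmorphM, rmorphD, rmorph1). Qed.

Lemma toC_ampH d l : toC (ampH d l) = 1 + toC d * toC l.
Proof. by rewrite /ampH rmorphD rmorph1 rmorphM. Qed.

Lemma dotmx_polarized_ge1 (d a b : R) : 1 <= '[polarized d a b].
Proof.
rewrite dotmx_mkvec ler_wpDl ?addr_ge0 ?dnorm_ge0//.
by rewrite dotmx_triple normr1 expr1n ler_wpDl// addr_ge0// exprn_ge0.
Qed.

Lemma polarized_neq0 (d a b : R) : polarized d a b != 0.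
Proof.
rewrite -(dnorm_eq0 (@dotmx (CC R) _)) gt_eqF//.
exact: lt_le_trans ltr01 (dotmx_polarized_ge1 d a b).
Qed.

Lemma dispersion_ratio (xi l d : R) : d ^+ 2 = 1 -> l != 0 ->
  xi ^+ 2 * (l + d) = l ^+ 2 * (l + 2 * d) ->
  (xi / l) ^+ 2 * (1 + d * l) = 2 + d * l.
Proof.
move=> d2 l0 disp; apply: (mulfI (expf_neq0 2 l0)).
rewrite mulrA -exprMn [l * _]mulrC divfK//.
have -> : 1 + d * l = d * (l + d) by rewrite -d2; ring.
have -> : 2 + d * l = d * (l + 2 * d).
  by rewrite mulrDr mulrCA -expr2 d2 mulr1 addrC.
by rewrite !(mulrCA _ d) disp.
Qed.

Section Eigenspace.
Variables (xi l d : R).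
Hypotheses (d2 : d ^+ 2 = 1) (l0 : l != 0).
Hypothesis disp : xi ^+ 2 * (l + d) = l ^+ 2 * (l + 2 * d).

Let q := polarized d (ampE d (xi / l) l) (ampH d l).

Let sqrI : 'i * 'i = -1 :> CC R.
Proof. by rewrite -expr2 sqrCi. Qed.

Let sqrD : toC d * toC d = 1.
Proof. by rewrite -rmorphM /= -expr2 d2 rmorph1. Qed.

Let toC_xi : toC xi = toC l * toC (xi / l).
Proof. by rewrite -rmorphM /= mulrC divfK. Qed.

Let ratio :
  toC (xi / l) * toC (xi / l) * (1 + toC d * toC l) = 2 + toC d * toC l.
Proof.
have := congr1 (@toC R) (dispersion_ratio d2 l0 disp).
by rewrite !(rmorphM, rmorphD, rmorph1, rmorphXn, rmorph_nat) /= expr2.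
Qed.

Lemma polarized_eigen : symbol_op xi q = toC l *: q.
Proof.
rewrite /q /polarized /Omega !(coordE R) symbol_op_coords toC_ampE toC_ampH.
rewrite toC_xi; move: sqrI sqrD ratio.
move: ('i : CC R) (toC d) (toC l) (toC (xi / l)) => I D L S iE dE sE.
congr (mkvec (triple _ _ _) (triple _ _ _) (triple _ _ _)); try by ring: iE dE.
- transitivity (I * D * L * (S * S * (1 + D * L)) - I * D * L); first by ring.
  by rewrite sE; ring.
- transitivity (L * (S * S * (1 + D * L)) - L); first by ring: iE dE.
  by rewrite sE; ring: iE dE.
Qed.

(** The longitudinal coordinates of an eigenvector vanish because [l] is
    nonzero.  Its components along the opposite polarization [Omega (- d)]
    vanish because the dispersion relations for [d] and [- d] have only
    [l = 0] as a common solution. *)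
Lemma eigen_polarized (v : vec9 R) :
  symbol_op xi v = toC l *: v -> exists c, v = c *: q.
Proof.
have [x0 [x1 [x2 [y0 [y1 [y2 [z0 [z1 [z2 ->]]]]]]]]] := vec9_eta v.
rewrite symbol_op_coords !(coordE R) => /mkvec_inj[].
move=> /triple_inj[ex0 ex1 ex2] /triple_inj[ey0 ey1 ey2].
move=> /triple_inj[ez0 ez1 ez2].
exists z2; rewrite /q /polarized /Omega !(coordE R) toC_ampE toC_ampH.
have L0 : toC l != 0 by rewrite fmorph_eq0.
have D0 : toC d != 0 by rewrite fmorph_eq0 -sqrf_eq0 d2 oner_eq0.
have eq0L (x : CC R) : 0 = toC l * x -> x = 0.
  by move/esym/eqP; rewrite mulf_eq0 (negPf L0) => /eqP.
rewrite (eq0L _ ex0) (eq0L _ ey0) (eq0L _ ez0).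
move: L0 D0 ex1 ex2 ey1 ey2 ez1 ez2 {ex0 ey0 ez0 eq0L}; rewrite toC_xi.
move: sqrI sqrD ratio.
move: ('i : CC R) (toC d) (toC l) (toC (xi / l)) => I D L S iE dE sE L0 D0.
move=> ex1 ex2 ey1 ey2 ez1 ez2.
have {}ex1 : x1 = S * y2 by apply: (mulfI L0); rewrite -ex1; ring.
have {}ex2 : x2 = - (S * y1) by apply: (mulfI L0); rewrite -ex2; ring.
have {}ey1 : S * S * y1 = y1 + z1.
  by apply: (mulfI L0); rewrite mulrDr -ey1 -ez1 ex2; ring.
have {}ey2 : S * S * y2 = y2 + z2.
  by apply: (mulfI L0); rewrite mulrDr -ey2 -ez2 ex1; ring.
(* Up to a constant factor, the components of H and M along Omega (- d). *)
pose hm := y1 - I * D * y2; pose zm := z1 - I * D * z2.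
have hmE : hm = (1 - D * L) * zm.
  rewrite /hm /zm.
  have -> : (1 - D * L) * (z1 - I * D * z2) =
     z1 - I * D * z2 - D * (L * z1) + D * D * I * (L * z2) by ring.
  by rewrite -ez1 -ez2; ring: iE dE.
have smE : S * S * hm = hm + zm.
  by rewrite /hm /zm mulrBr [S * S * (_ * _)]mulrCA ey1 ey2; ring.
have zm0 : zm = 0.
  (* Eliminate S * S between smE and sE. *)
  have : 2 * D * L * zm = 0.
    have -> : 2 * D * L * zm =
        (S * S * (1 + D * L) - (2 + D * L)) * ((1 - D * L) * zm)
        - (1 + D * L) * (S * S * ((1 - D * L) * zm) - ((1 - D * L) * zm + zm)).
      by ring.
    by rewrite sE -hmE smE; ring.
  by move/eqP; rewrite !mulf_eq0 pnatr_eq0 (negPf L0) (negPf D0) => /eqP.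
have hm0 : hm = 0 by rewrite hmE zm0 mulr0.
have z1E : z1 = I * D * z2 by apply/eqP; rewrite -subr_eq0; apply/eqP.
have y1E : y1 = I * D * y2 by apply/eqP; rewrite -subr_eq0; apply/eqP.
have y2E : y2 = (1 + D * L) * z2.
  by rewrite mulrDl -mulrA -ez2 y1E z1E; ring: iE dE.
rewrite ex1 ex2 y1E z1E y2E.
by congr (mkvec (triple _ _ _) (triple _ _ _) (triple _ _ _)); ring: iE dE.
Qed.

Lemma eigenspace_polarized : (eigenspace (symbol xi) (toC l) :=: q)%MS.
Proof.
apply/eqmxP/andP; split; last first.
  by apply/eigenspaceP; rewrite mul_symbol polarized_eigen.
apply/rV_subP => v /eigenspaceP; rewrite mul_symbol => /eigen_polarized[c ->].
exact: scalemx_sub.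
Qed.

End Eigenspace.

Lemma cvg_line_proj_polarized (d a0 b0 : R) (T : Type) (F : set_system T)
    (a b : T -> R) :
  Filter F -> a x @[x --> F] --> a0 -> b x @[x --> F] --> b0 ->
  line_proj (polarized d (a x) (b x)) @[x --> F] -->
  line_proj (polarized d a0 b0).
Proof.
move=> FF aa0 bb0.
pose e := mkvec (- 'i *: Omega d) 0 0; pose h := mkvec 0 (Omega d) 0.
pose m := mkvec 0 0 (Omega d).
have pE x y : polarized d x y = toC x *: e + toC y *: h + m.
  by rewrite /polarized /e /h /m !mkvecZ !mkvecD !scaler0 !addr0 !add0r.
have -> : (fun x => line_proj (polarized d (a x) (b x))) =
    (fun x => line_proj (toC (a x) *: e + toC (b x) *: h + m)).
  by apply/funext => x; rewrite pE.
have q0 : toC a0 *: e + toC b0 *: h + m != 0 by rewrite -pE polarized_neq0.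
rewrite pE.
exact: (@cvg_line_proj_affine (CC R) _ e h m T F
  (fun x => toC (a x)) (fun x => toC (b x)) (toC a0) (toC b0) FF q0
  (cvg_toC FF aa0) (cvg_toC FF bb0)).
Qed.

End Symbol.

(** * The projectors of the branches *)

Section Branches.
Variables (R : realType) (lambda : nat -> R -> R).
Hypothesis lambdaP : branches lambda.

Lemma sqr_delta j : delta R j ^+ 2 = 1.
Proof. by rewrite /delta sqrr_sign. Qed.

Lemma branch_den_neq0 j xi : (1 <= j <= 6)%N -> lambda j xi + delta R j != 0.
Proof.
have [_ _ l1 l2 l3 lsym] := lambdaP.
have := l1 xi; have := l2 xi; have /andP[] := l3 xi.
have := lsym 4%N xi isT; have := lsym 5%N xi isT; have := lsym 6%N xi isT.
rewrite /delta; case: j => [|[|[|[|[|[|[|//]]]]]]] //=;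
  by rewrite ?subSS ?subn0 ?exprS ?expr0; move=> *; apply/eqP; lra.
Qed.

Definition branch_sgn (j : nat) : R := if (j <= 3)%N then 1 else -1.

Lemma branch_sgn_ge0 j xi : (1 <= j <= 6)%N -> 0 <= branch_sgn j * lambda j xi.
Proof.
have [_ _ l1 l2 l3 lsym] := lambdaP.
have := l1 xi; have := l2 xi; have /andP[] := l3 xi.
have := lsym 4%N xi isT; have := lsym 5%N xi isT; have := lsym 6%N xi isT.
rewrite /branch_sgn; case: j => [|[|[|[|[|[|[|//]]]]]]] //=;
  by rewrite ?subSS ?subn0; move=> *; lra.
Qed.

Lemma branch_cubic j xi : (1 <= j <= 6)%N ->
  xi ^+ 2 * (lambda j xi + delta R j) =
  lambda j xi ^+ 2 * (lambda j xi + 2 * delta R j).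
Proof.
move=> j16; rewrite (branch_dispersion lambdaP xi j16).
have := branch_den_neq0 xi j16; move: (lambda j xi) (delta R j) => l d dn.
by field.
Qed.

Lemma branch_neq0 j xi : (1 <= j <= 6)%N -> xi != 0 -> lambda j xi != 0.
Proof.
move=> j16; apply: contraNN => /eqP l0.
by rewrite -sqrf_eq0 (branch_dispersion lambdaP xi j16) l0 expr0n mulr0.
Qed.

(** A continuous extension of [xi / lambda j xi] from the positive reals to
    [xi = 0], where [lambda j] may vanish. *)
Definition slope (j : nat) (xi : R) : R :=
  branch_sgn j *
  Num.sqrt ((lambda j xi + 2 * delta R j) / (lambda j xi + delta R j)).

Lemma slopeE j xi : (1 <= j <= 6)%N -> 0 < xi -> slope j xi = xi / lambda j xi.
Proof.
move=> j16 xi0; have l0 := branch_neq0 j16 (lt0r_neq0 xi0).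
rewrite /slope.
have -> : (lambda j xi + 2 * delta R j) / (lambda j xi + delta R j) =
    (xi / lambda j xi) ^+ 2.
  by rewrite expr_div_n (branch_dispersion lambdaP xi j16) mulfK// expf_neq0.
rewrite sqrtr_sqr normrM normfV (gtr0_norm xi0) mulrCA; congr (_ * _).
have := branch_sgn_ge0 xi j16; rewrite /branch_sgn; case: ifP => _.
  by rewrite !mul1r => /ger0_norm ->.
by rewrite !mulN1r oppr_ge0 => /ler0_norm ->; rewrite invrN opprK.
Qed.

Lemma slope_continuous j : (1 <= j <= 6)%N -> continuous (slope j).
Proof.
move=> j16 xi; apply: cvgM; first exact: cvg_cst.
apply: (@continuous_cvg _ _ _ _ _ _ Num.sqrt); first exact: sqrt_continuous.
have lc : lambda j x @[x --> xi] --> lambda j xi by exact: branch_continuous.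
by apply: cvgM; [|apply: cvgV; first exact: branch_den_neq0];
  apply: cvgD => //; exact: cvg_cst.
Qed.

Lemma eigenprojE j xi : (1 <= j <= 6)%N -> xi != 0 ->
  eigenproj lambda j xi =
  line_proj (polarized (delta R j)
    (ampE (delta R j) (xi / lambda j xi) (lambda j xi))
    (ampH (delta R j) (lambda j xi))).
Proof.
move=> j16 xi0; apply: proj_ortho_line; first exact: polarized_neq0.
exact: eigenspace_polarized (sqr_delta j) (branch_neq0 j16 xi0)
  (branch_cubic xi j16).
Qed.

(** The amplitude [a] is left existential because [B] reads only the second
    and third blocks.  At [xi = 0] the projectors converge because [slope] is
    continuous there. *)
Lemma PiE j xi : (1 <= j <= 6)%N ->
  exists a, Pi lambda j xi =
    line_proj (polarized (delta R j) a (ampH (delta R j) (lambda j xi))).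
Proof.
move=> j16; rewrite /Pi; have [->|xi0] := eqVneq xi 0; last first.
  exists (ampE (delta R j) (xi / lambda j xi) (lambda j xi)).
  by rewrite eigenprojE.
exists (ampE (delta R j) (slope j 0) (lambda j 0)).
apply: cvg_lim; first exact: norm_hausdorff.
have lc : lambda j x @[x --> 0] --> lambda j 0 by exact: branch_continuous.
have hc : ampH (delta R j) (lambda j x) @[x --> 0] -->
    ampH (delta R j) (lambda j 0).
  by apply: cvgD; [exact: cvg_cst|apply: cvgM => //; exact: cvg_cst].
have ac : ampE (delta R j) (slope j x) (lambda j x) @[x --> 0] -->
    ampE (delta R j) (slope j 0) (lambda j 0).
  apply: cvgM => //.
  by apply: cvgM; [exact: cvg_cst|exact: slope_continuous].
have base := @cvg_line_proj_polarized R (delta R j) _ _ _ _ _ _ _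
  (cvg_at_right_filter ac) (cvg_at_right_filter hc).
apply: (cvg_trans _ (base _)); apply: near_eq_cvg; near=> x.
have x0 : 0 < x by near: x; exact: nbhs_right_gt.
by rewrite slopeE// eigenprojE// lt0r_neq0.
Unshelve. all: by end_near. Qed.

End Branches.

(** * The bilinear estimate *)

Section Estimate.
Variable R : realType.

(** Up to the factor [c * c'], the product [u3 x v2 + v3 x u2] is [b' - b]
    times [Omega d x Omega d' = (i (d - d'), 0, 0)]. *)
Lemma B_polarized (d d' a b a' b' : R) (c c' : CC R) :
  let w := 'i * toC ((d - d') * (b' - b) / 2) * (c * c') in
  B (c *: polarized d a b) (c' *: polarized d' a' b') *m Pi_s R =
  mkvec 0 (triple w 0 0) (triple (- w) 0 0).
Proof.
have -> : toC ((d - d') * (b' - b) / 2) =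
    (toC d - toC d') * (toC b' - toC b) * 2^-1.
  by rewrite !(rmorphM, rmorphB) fmorphV rmorph_nat.
move=> w; rewrite /polarized [c *: _]mkvecZ [c' *: _]mkvecZ B_mkvec.
rewrite /w /Omega.
move: ('i : CC R) (toC d) (toC d') (toC b) (toC b') (2^-1 : CC R).
move=> I D D' b1 b1' h.
rewrite !tripleZ !cross_triple tripleD tripleN -triple000 mkvecZ !tripleZ.
rewrite mul_Pi_s.
by congr (mkvec (triple _ _ _) (triple _ _ _) (triple _ _ _)); ring.
Qed.

Lemma vnorm_B_line_proj_le (d d' a b a' b' : R) (u v : vec9 R) :
  vnorm (B (u *m line_proj (polarized d a b))
           (v *m line_proj (polarized d' a' b')) *m Pi_s R)
  <= `|(d - d') * (b' - b)| * vnorm u * vnorm v.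
Proof.
have [c -> cu] := line_proj_coef u (dotmx_polarized_ge1 d a b).
have [c' -> cv] := line_proj_coef v (dotmx_polarized_ge1 d' a' b').
rewrite B_polarized; move: (_ * (b' - b)) => g.
rewrite -ler_sqr ?nnegrE ?mulr_ge0 ?vnorm_ge0// -toC_le !rmorphXn /=.
rewrite sqr_toC_vnorm dotmx_mkvec !dotmx_triple linear0l add0r.
rewrite normrN normr0 expr0n /= !addr0 !normrM normCi mul1r norm_toC.
rewrite !rmorphM !exprMn !sqr_toC_vnorm.
move: cu cv (exprn_ge0 2 (normr_ge0 c)) (exprn_ge0 2 (normr_ge0 c')).
move: (`|c| ^+ 2) (`|c'| ^+ 2) => x y xu yv x0 y0.
rewrite -mulrDl -!rmorphXn -rmorphD -mulrA.
apply: ler_pM; [|exact: mulr_ge0| |exact: ler_pM].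
- by rewrite -(rmorph0 (@toC R)) toC_le addr_ge0 ?exprn_ge0.
- by rewrite toC_le !real_normK ?num_real//; nra.
Qed.

End Estimate.

Theorem proposition3p1 (R : realType) (lambda : nat -> R -> R)
    (lambdaP : branches lambda) :
  exists2 C : R, 0 < C &
    forall (xi eta : R) (j j' : nat) (u v : 'rV[CC R]_(3 + (3 + 3))),
      (1 <= j <= 6)%N -> (1 <= j' <= 6)%N ->
      vnorm (B (u *m Pi lambda j xi) (v *m Pi lambda j' eta) *m Pi_s R)
      <= C * `|lambda j xi + lambda j' eta| * vnorm u * vnorm v.
Proof.
exists 2 => // xi eta j j' u v j16 j'16.
have [a ->] := PiE lambdaP xi j16; have [a' ->] := PiE lambdaP eta j'16.
apply: le_trans (vnorm_B_line_proj_le _ _ _ _ _ _ _ _) _.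
do 2 (apply: ler_wpM2r; first exact: vnorm_ge0).
set d := delta R j; set d' := delta R j'.
have -> : (d - d') * (ampH d' (lambda j' eta) - ampH d (lambda j xi)) =
    (d * d' - 1) * (lambda j xi + lambda j' eta).
  have dd : d ^+ 2 = 1 by exact: sqr_delta.
  have dd' : d' ^+ 2 = 1 by exact: sqr_delta.
  by rewrite /ampH; ring: dd dd'.
rewrite normrM ler_wpM2r//.
by rewrite (le_trans (ler_normB _ _))// normrM !normr_sign normr1; lra.
Qed.
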